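(* Let $k,s\ge 1$ be integers and $n=2ks$. Let $G\in\mathbb C^{n\times n}$ be a unitary matrix that is CMV structured with block size $k$. Then $G$ can be factored as $G=G_1G_2$, where $G_1,G_2\in\mathbb C^{n\times n}$ are block diagonal unitary matrices of the form $$G_1=\operatorname{diag}(G_{1,1},\ldots,G_{1,s}),\qquad G_2=\operatorname{diag}(I_k,G_{2,2},\ldots,G_{2,s+1}),$$ such that $G_{2,s+1}$ has $k$ rows and columns, and all the other blocks $G_{i,j}$ (that is, $G_{1,1},\dots,G_{1,s}$ and $G_{2,2},\dots,G_{2,s}$) have $2k$ rows and columns and bandwidth $k$, with both $G_{i,j}(k+1:2k,\,1:k)$ and $G_{i,j}(1:k,\,k+1:2k)$ triangular matrices of full rank. Moreover, each matrix $G$ admitting such a factored form is in turn CMV structured with block size $k$.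
   Context: CMV structure: let $n=2ks$ and partition a matrix $G\in\mathbb C^{n\times n}$ into $2s\times 2s$ blocks $G^{[p,q]}$ of size $k\times k$. A unitary $G$ is called CMV structured with block size $k$ if it has the block shape $$G=\begin{bmatrix}\times&\times&L_3\\ R_1&\times&\times\\ &\times&\times&\times&L_5\\ &R_2&\times&\times&\times\\ &&&\times&\times\\ &&&R_4&\times&\ddots\\ &&&&\ddots&\ddots\end{bmatrix},$$ where blank blocks are zero, $\times$ denotes an arbitrary (possibly nonzero) $k\times k$ block, the $R_i$ are $k\times k$ nonsingular upper triangular matrices and the $L_i$ are $k\times k$ nonsingular lower triangular matrices. Explicitly (with blocks of index exceeding $2s$ discarded): block rows $1$ and $2$ are zero outside block columns $1,2,3$; for $2\le j\le s$, block rows $2j-1$ and $2j$ are zero outside block columns $2j-2,\dots,2j+1$; $G^{[2j-1,2j+1]}=L_{2j+1}$ is lower triangular nonsingular for $1\le j\le s-1$; $G^{[2,1]}=R_1$ is upper triangular nonsingular; and $G^{[2j,2j-2]}=R_{2j-2}$ is upper triangular nonsingular for $2\le j\le s$. A square matrix has bandwidth $k$ if its $(i,j)$ entry vanishes whenever $|i-j|>k$. $M(a:b,c:d)$ is the submatrix of $M$ with rows $a,\dots,b$ and columns $c,\dots,d$. *)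

(* Defs.v *)
From HB Require Import structures.
From mathcomp Require Import all_boot all_order all_algebra.
From mathcomp Require Import spectral complex reals.

Set Implicit Arguments.
Unset Strict Implicit.
Unset Printing Implicit Defensive.

Import GRing.Theory.
Local Open Scope ring_scope.

Definition bandwidth (C : nmodType) (k n : nat) (M : 'M[C]_n) : Prop :=
  forall i j : 'I_n, (k < `|i - j|)%N -> M i j = 0.

(* [is_trig_mx] is MathComp's predicate for lower triangular matrices. *)
Definition lower_trig_mx (C : nmodType) (n : nat) (M : 'M[C]_n) : bool :=
  is_trig_mx M.
Definition upper_trig_mx (C : nmodType) (n : nat) (M : 'M[C]_n) : bool :=
  is_trig_mx M^T.
Definition trig_mx (C : nmodType) (n : nat) (M : 'M[C]_n) : bool :=
  lower_trig_mx M || upper_trig_mx M.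

Lemma dim_blocks (k s : nat) :
  (2 * k * s = \sum_(p < 2 * s) k)%N.
Proof. by rewrite sum_nat_const card_ord mulnAC. Qed.

Lemma dim_G1 (k s : nat) : (\sum_(j < s) (k + k) = 2 * k * s)%N.
Proof. by rewrite sum_nat_const card_ord addnn -mul2n mulnC. Qed.

Lemma dim_G2 (k s : nat) : (0 < s)%N ->
  (k + (\sum_(j < s.-1) (k + k) + k) = 2 * k * s)%N.
Proof.
case: s => // s _; rewrite dim_G1 mulnS mul2n -addnn /=.
by rewrite addnCA addnC.
Qed.

(* G^{[p+1,q+1]}: the ordinals [p] and [q] count blocks from 0. *)
Definition kblock (C : nmodType) (k s : nat) (G : 'M[C]_(2 * k * s)%N)
    (p q : 'I_(2 * s)) : 'M[C]_k :=
  submxblock (p_ := fun=> k) (q_ := fun=> k)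
    (castmx (dim_blocks k s, dim_blocks k s) G) p q.

(* The 1-based row and column block indices are [p.+1] and [q.+1]. Blocks of
   index exceeding 2s are discarded because [p] and [q] range over ordinals. *)
Record cmv_structured (C : numClosedFieldType) (k s : nat)
    (G : 'M[C]_(2 * k * s)%N) : Prop := CmvStructured {
  cmv_unitary : G \is unitarymx;
  cmv_zero_first : forall p q : 'I_(2 * s),
    (p.+1 = 1 \/ p.+1 = 2)%N -> ~~ (1 <= q.+1 <= 3)%N ->
    kblock G p q = 0;
  cmv_zero : forall (j : nat) (p q : 'I_(2 * s)), (2 <= j <= s)%N ->
    (p.+1 = 2 * j - 1 \/ p.+1 = 2 * j)%N ->
    ~~ (2 * j - 2 <= q.+1 <= 2 * j + 1)%N ->
    kblock G p q = 0;
  cmv_L : forall (j : nat) (p q : 'I_(2 * s)), (1 <= j <= s - 1)%N ->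
    (p.+1 = 2 * j - 1)%N -> (q.+1 = 2 * j + 1)%N ->
    lower_trig_mx (kblock G p q) /\ kblock G p q \in unitmx;
  cmv_R1 : forall p q : 'I_(2 * s), (p.+1 = 2)%N -> (q.+1 = 1)%N ->
    upper_trig_mx (kblock G p q) /\ kblock G p q \in unitmx;
  cmv_R : forall (j : nat) (p q : 'I_(2 * s)), (2 <= j <= s)%N ->
    (p.+1 = 2 * j)%N -> (q.+1 = 2 * j - 2)%N ->
    upper_trig_mx (kblock G p q) /\ kblock G p q \in unitmx
}.

(* [dlsubmx B] is B(k+1:2k, 1:k) and [ursubmx B] is B(1:k, k+1:2k). *)
Definition factor_block (C : fieldType) (k : nat) (B : 'M[C]_(k + k)) : Prop :=
  [/\ bandwidth k B,
      trig_mx (dlsubmx B) /\ \rank (dlsubmx B) = k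
    & trig_mx (ursubmx B) /\ \rank (ursubmx B) = k].

(* G_1 = diag(G_{1,1}, ..., G_{1,s}); [B j] is G_{1,j+1}. *)
Definition left_factor (C : numClosedFieldType) (k s : nat)
    (G1 : 'M[C]_(2 * k * s)%N) : Prop :=
  G1 \is unitarymx /\
  exists B : 'I_s -> 'M[C]_(k + k),
    G1 = castmx (dim_G1 k s, dim_G1 k s) (\mxdiag_(j < s) B j) /\
    forall j, factor_block (B j).

(* G_2 = diag(I_k, G_{2,2}, ..., G_{2,s}, G_{2,s+1}); [B j] is G_{2,j+2} and
   [E] is the trailing k x k block G_{2,s+1}. *)
Definition right_factor (C : numClosedFieldType) (k s : nat) (hs : (0 < s)%N)
    (G2 : 'M[C]_(2 * k * s)%N) : Prop :=
  G2 \is unitarymx /\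
  exists (B : 'I_s.-1 -> 'M[C]_(k + k)) (E : 'M[C]_k),
    G2 = castmx (dim_G2 k hs, dim_G2 k hs)
           (block_mx (1%:M : 'M[C]_k) 0
                     0 (block_mx (\mxdiag_(j < s.-1) B j) 0
                                 0 E)) /\
    forall j, factor_block (B j).

(* Main.v *)
(* Group the block rows of G in pairs (2j-1, 2j). The first nonzero block column
   a of the pair has a nonsingular upper triangular lower half, so orthonormalizing
   a and completing it gives a unitary B_j = [U V] with U spanning the columns of a,
   in which triangularity of the off-diagonal blocks can be arranged: for U it is
   inherited from a, and the basis V of the complement can be rotated.
   Put G_1 = diag(B_j) and G_2 = G_1^* G. Two columns of G whose supports meet in a
   single pair of block rows are orthogonal within that pair. Applied to the first
   (last) block column of each pair, this kills the entries of G_2 outside the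
   block pattern diag(k, 2k, ..., 2k, k); the remaining conditions on G_2 follow by
   dividing the triangular blocks of G by those of G_1. *)

Require Import Defs.
From HB Require Import structures.
From mathcomp Require Import all_boot all_order all_algebra.
From mathcomp Require Import spectral complex reals.
From mathcomp Require Import zify.

Set Implicit Arguments.
Unset Strict Implicit.
Unset Printing Implicit Defensive.

Import GRing.Theory Num.Theory.
Local Open Scope ring_scope.
Local Open Scope sesquilinear_scope.

(** * Triangular matrices and the shape of the factor blocks *)

Section Triangular.

Lemma lower_trig_mul (R : pzSemiRingType) n (A B : 'M[R]_n) :
  lower_trig_mx A -> lower_trig_mx B -> lower_trig_mx (A *m B).
Proof.
move=> /is_trig_mxP lA /is_trig_mxP lB; apply/is_trig_mxP => i j lt_ij.
rewrite mxE big1 // => r _; have [lt_ir|le_ri] := ltnP i r.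
  by rewrite lA // mul0r.
by rewrite lB ?mulr0 // (leq_ltn_trans le_ri).
Qed.

Lemma upper_trig_mul (R : comPzSemiRingType) n (A B : 'M[R]_n) :
  upper_trig_mx A -> upper_trig_mx B -> upper_trig_mx (A *m B).
Proof. by move=> uA uB; rewrite /upper_trig_mx trmx_mul; apply: lower_trig_mul. Qed.

(** Forward substitution: once the earlier rows of [B] vanish right of the diagonal, entry [(i, j)]
    of [A *m B] with [i < j] reduces to [A i i * B i j], and [A i i] is nonzero. *)
Lemma lower_trig_divl (F : fieldType) n (A B : 'M[F]_n) : A \in unitmx ->
  lower_trig_mx A -> lower_trig_mx (A *m B) -> lower_trig_mx B.
Proof.
move=> uA lA /is_trig_mxP lAB; apply/is_trig_mxP => i j.
have Aii r : A r r != 0.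
  by move: uA; rewrite unitmxE det_trig // unitfE => /prodf_neq0 ->.
move/is_trig_mxP: lA => lA.
elim/ltn_ind: {i}(i : nat) {-2}i (erefl (i : nat)) => m IHm i eq_im lt_ij.
have := lAB i j lt_ij; rewrite mxE (bigD1 i) //= big1 ?addr0; last first.
  move=> r ne_ri; have [lt_ir|le_ri] := ltnP i r; first by rewrite lA // mul0r.
  have lt_ri : (r < i)%N by rewrite ltn_neqAle ne_ri.
  by rewrite (IHm r) ?mulr0 -?eq_im // (ltn_trans lt_ri).
by move/eqP; rewrite mulf_eq0 (negPf (Aii i)) => /eqP.
Qed.

(** Entries [(i, j)] of the off-diagonal blocks lie at distance [k + i - j] or [k + j - i] from the
    diagonal of [B], so bandwidth [k] decides which triangle vanishes; the diagonal blocks stay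
    within distance [k]. *)
Lemma factor_blockP (F : fieldType) k (B : 'M[F]_(k + k)) : factor_block B <->
  [/\ upper_trig_mx (dlsubmx B), dlsubmx B \in unitmx,
      lower_trig_mx (ursubmx B) & ursubmx B \in unitmx].
Proof.
rewrite -!row_free_unit /row_free; split.
  move=> [band [_ /eqP ->] [_ /eqP ->]]; split=> //.
    apply/is_trig_mxP => i j lt_ij; rewrite !mxE; apply: band => /=; lia.
  apply/is_trig_mxP => i j lt_ij; rewrite !mxE; apply: band => /=; lia.
move=> [up /eqP rk_up low /eqP rk_low]; split; last 2 first.
- by rewrite /trig_mx up orbT.
- by rewrite /trig_mx low.
move=> i j; case: (split_ordP i) => i' ->; case: (split_ordP j) => j' -> /= far;
  have lt_i := ltn_ord i'; have lt_j := ltn_ord j'.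
- lia.
- by move/is_trig_mxP: low => /(_ i' j'); rewrite !mxE => -> //; lia.
- by move/is_trig_mxP: up => /(_ j' i'); rewrite !mxE => -> //; lia.
- lia.
Qed.

End Triangular.

(** * Orthonormalization and unitary completion *)

Section Frame.
Variable (C : numClosedFieldType).

Lemma trC_mul m n p (A : 'M[C]_(m, n)) (B : 'M[C]_(n, p)) :
  (A *m B)^t* = B^t* *m A^t*.
Proof. by rewrite trmx_mul map_mxM. Qed.

(** Gram-Schmidt puts row [i] of [A] in the span of the first [i + 1] rows of [schmidt A], hence
    orthogonal to the later ones. *)
Lemma schmidt_lq m n (A : 'M[C]_(m, n)) : (m <= n)%N ->
  lower_trig_mx (A *m (schmidt A)^t*) /\
  A = A *m (schmidt A)^t* *m schmidt A.
Proof.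
move=> le_mn; have SU := schmidt_unitarymx A le_mn.
split; last first.
  have /submxP[D AE] := schmidt_sub A.
  by rewrite {2}AE (mulmxtVK _ SU) -AE.
apply/is_trig_mxP => i j lt_ij.
have : (row i A <= kermx ((row j (schmidt A))^t*))%MS.
  apply: submx_trans (row_schmidt_sub A i) _; apply/sumsmx_subP => l le_li.
  rewrite genmxE; apply/sub_kermxP.
  have /matrixP/(_ l j) := unitarymxP SU.
  rewrite !mxE => SE; apply/matrixP => x y; rewrite !mxE; move: SE.
  have -> : (l == j) = false by apply/eqP => lj; move: le_li; rewrite lj; lia.
  by move=> SE; apply: etrans SE; apply: eq_bigr => z _; rewrite !mxE.
move/sub_kermxP/matrixP => /(_ 0 0); rewrite !mxE => AS.
by apply: etrans AS; apply: eq_bigr => z _; rewrite !mxE.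
Qed.

Lemma orthonormal_qr m n (A : 'M[C]_(m, n)) : (n <= m)%N ->
  exists (U : 'M[C]_(m, n)) (X : 'M[C]_n),
    [/\ U^t* *m U = 1%:M, A = U *m X, upper_trig_mx X
      & A^t* *m A = 1%:M -> X = 1%:M].
Proof.
(* An [A] with orthonormal columns is kept as it is, with [X = 1]; this later yields the leading
   [I_k] of [G_2]. *)
move=> le_nm; have [A1|nA1] := eqVneq (A^t* *m A) 1%:M.
  exists A, 1%:M; rewrite mulmx1; split=> //.
  by rewrite /upper_trig_mx trmx1 /lower_trig_mx scalar_mx_is_trig.
have [low AE] := schmidt_lq A^T le_nm; set S := schmidt A^T in low AE.
exists S^T, (A^T *m S^t*)^T; split.
- have /unitarymxP SU := schmidt_unitarymx A^T le_nm.
  rewrite trmxK; have := congr1 (map_mx Num.conj) SU; rewrite map_mxM map_mx1 => <-.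
  by congr (_ *m _); apply/matrixP => i j; rewrite !mxE /= conjCK.
- by rewrite -[LHS]trmxK {1}AE trmx_mul.
- by rewrite /upper_trig_mx trmxK.
- by move=> A1; rewrite A1 eqxx in nA1.
Qed.

(* B = [U V]: U comes from a QR factorization of A, and an orthonormal basis P of
   the complement of U has a nonsingular top half because that of U has a
   nonsingular bottom half; an LQ factorization of this half rotates P to V. *)
Lemma unitary_frame k (A : 'M[C]_(k + k, k)) :
  upper_trig_mx (dsubmx A) -> dsubmx A \in unitmx ->
  exists (B : 'M[C]_(k + k)) (X : 'M[C]_k),
    [/\ B \is unitarymx, factor_block B, B^t* *m A = col_mx X 0,
        upper_trig_mx X /\ X \in unitmx & A^t* *m A = 1%:M -> X = 1%:M].
Proof.
move=> upA unA; have [U [X [UU AE upX X1]]] := orthonormal_qr A (leq_addr k k).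
have A2E : dsubmx A = dsubmx U *m X by rewrite AE mul_dsub_mx.
move: (unA); rewrite A2E unitmx_mul => /andP[unU unX].
have upU : upper_trig_mx (dsubmx U).
  apply: (@lower_trig_divl _ _ X^T); rewrite ?unitmx_tr //.
  by rewrite -trmx_mul -A2E.
have rkU : \rank (kermx U) = k.
  rewrite mxrank_ker.
  suff -> : \rank U = k by rewrite addnK.
  apply/eqP; rewrite eqn_leq rank_leq_col /=.
  by rewrite -[leqLHS](mxrank1 C k) -UU mxrankM_maxr.
have [P PU PK] : exists2 P : 'M[C]_(k, k + k), P \is unitarymx & P *m U = 0.
  (* The row count [\rank (kermx U)] equals [k] only propositionally, so the basis is first built
     with that count. *)
  suff: exists2 P : 'M[C]_(\rank (kermx U), k + k), P \is unitarymx & P *m U = 0.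
    by rewrite rkU.
  exists (schmidt (row_base (kermx U))).
    exact/schmidt_unitarymx/rank_leq_col.
  apply/sub_kermxP.
  by rewrite eqmx_schmidt_free ?row_base_free // eq_row_base.
have unP : lsubmx P \in unitmx.
  (* With halves indexed 1 and 2, [P *m U = 0] expresses [P2] as [- P1 U1] times the inverse of
     [U2]; substituting into [P *m P^t* = 1] exhibits a right inverse of [P1]. *)
  have : lsubmx P *m ((lsubmx P)^t* - usubmx U *m invmx (dsubmx U) *m (rsubmx P)^t*) = 1%:M.
    move/unitarymxP: PU; rewrite -{1 2}[P]hsubmxK => <-.
    rewrite tr_row_mx map_col_mx mul_row_col mulmxBr; congr (_ + _).
    rewrite !mulmxA -mulNmx; congr (_ *m _).
    move: PK; rewrite -{1}[P]hsubmxK -{1}[U]vsubmxK mul_row_col => /eqP.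
    by rewrite addr_eq0 => /eqP ->; rewrite mulNmx opprK mulmxK.
  by case/mulmx1_unit.
(* The rotation [S] is chosen to make the top half of [V] lower triangular. *)
have [lowS _] := schmidt_lq ((lsubmx P)^t*) (leqnn k).
set S := schmidt _ in lowS.
have SU : S \is unitarymx by exact: schmidt_unitarymx.
pose V := P^t* *m S^t*.
have VT : V^t* = S *m P by rewrite trC_mul !trmxCK.
have VV : V^t* *m V = 1%:M.
  by rewrite VT /V mulmxA (mulmxtVK _ PU); apply/unitarymxP.
have VU : V^t* *m U = 0 by rewrite VT -mulmxA PK mulmx0.
have UV : U^t* *m V = 0.
  by rewrite -[U^t* *m V]trmxCK trC_mul trmxCK VU trmx0 map_mx0.
have BB : (row_mx U V)^t* *m row_mx U V = 1%:M.
  by rewrite tr_row_mx map_col_mx mul_col_row UU VV UV VU -scalar_mx_block.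
have V1E : usubmx V = (lsubmx P)^t* *m S^t*.
  by rewrite /V -mul_usub_mx; congr (_ *m _); apply/matrixP => i j; rewrite !mxE.
exists (row_mx U V), X; split=> //.
- by apply/unitarymxP; exact: mulmx1C BB.
- apply/factor_blockP.
  have -> : dlsubmx (row_mx U V) = dsubmx U
    by apply/matrixP => i j; rewrite 2![LHS]mxE row_mxEl [RHS]mxE.
  have -> : ursubmx (row_mx U V) = usubmx V
    by apply/matrixP => i j; rewrite 2![LHS]mxE row_mxEr [RHS]mxE.
  split=> //; rewrite V1E // unitmx_mul.
  by rewrite !map_unitmx !unitmx_tr unP unitarymx_unit.
- by rewrite tr_row_mx map_col_mx mul_col_mx AE !mulmxA UU VU mul1mx mul0mx.
Qed.

End Frame.

(** * Entries and products of matrices cut into blocks *)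

Section BlockIndex.
Variables (k s : nat).

Definition bidx (p : 'I_(2 * s)) (a : 'I_k) : 'I_(2 * k * s)%N :=
  cast_ord (esym (dim_blocks k s)) (tagnat.Rank p a).

Lemma Rank_const (n c : nat) (p : 'I_n) (a : 'I_c) :
  tagnat.Rank (p_ := fun=> c) p a = (p * c + a)%N :> nat.
Proof.
rewrite tagnat.RankEsum (big_ord_narrow (F := fun=> c) (ltnW (ltn_ord p))).
by rewrite sum_nat_const card_ord.
Qed.

Lemma bidxE p a : bidx p a = (p * k + a)%N :> nat.
Proof. exact: Rank_const. Qed.

Lemma kblockE (C : nmodType) (G : 'M[C]_(2 * k * s)%N) p q a b :
  kblock G p q a b = G (bidx p a) (bidx q b).
Proof. by rewrite !mxE castmxE. Qed.

Lemma bidxP (x : 'I_(2 * k * s)%N) : exists p a, x = bidx p a.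
Proof.
pose y := cast_ord (dim_blocks k s) x.
exists (tagnat.sig1 y), (tagnat.sig2 y).
by rewrite /bidx tagnat.sig2K; apply: val_inj.
Qed.

Lemma eq_kblock (C : nmodType) (A B : 'M[C]_(2 * k * s)%N) :
  (forall p q, kblock A p q = kblock B p q) -> A = B.
Proof.
move=> eqAB; apply/matrixP => x y.
have [p [a ->]] := bidxP x; have [q [b ->]] := bidxP y.
by rewrite -!kblockE eqAB.
Qed.

Lemma kblock_mul (C : pzSemiRingType) (A B : 'M[C]_(2 * k * s)%N) p q :
  kblock (A *m B) p q = \sum_r kblock A p r *m kblock B r q.
Proof.
(* Generalizing the dimension allows substitution, after which the casts are identities. *)
rewrite /kblock; move: (dim_blocks k s) A B.
generalize (2 * k * s)%N => n e; subst n => A B; rewrite !castmx_id.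
by rewrite -{1}(submxblockK A) -{1}(submxblockK B) mul_mxblock mxblockK.
Qed.

Lemma mxdiagE (C : nmodType) (n c : nat) (B : 'I_n -> 'M[C]_c) j j' a b :
  (\mxdiag_(i < n) B i) (tagnat.Rank j a) (tagnat.Rank j' b) =
  if j == j' then B j a b else 0.
Proof.
have := congr1 (fun M : 'M_c => M a b)
  (mxblockK (fun j j' => if j == j' then conform_mx 0 (B j) else 0 : 'M_c) j j').
by rewrite mxE => ->; case: eqP => _; rewrite ?conform_mx_id ?mxE.
Qed.

End BlockIndex.

(** * Blocks with natural number indices; the block patterns of [G_1] and [G_2] *)

Section NatBlocks.
Variables (k s : nat).

(* [kblock] with natural number indices, and zero blocks out of range. *)
Definition kb (C : nmodType) (G : 'M[C]_(2 * k * s)%N) (p q : nat) : 'M[C]_k :=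
  if insub p is Some p' then
    if insub q is Some q' then kblock G p' q' else 0
  else 0.

Lemma kbE (C : nmodType) (G : 'M[C]_(2 * k * s)%N) (p q : 'I_(2 * s)) :
  kb G p q = kblock G p q.
Proof. by rewrite /kb !valK. Qed.

Lemma kb_oor (C : nmodType) (G : 'M[C]_(2 * k * s)%N) (p q : nat) :
  (2 * s <= p)%N || (2 * s <= q)%N -> kb G p q = 0.
Proof.
rewrite /kb; case: insubP => //= p' lt_p _; case: insubP => //= q' lt_q _.
by move: lt_p lt_q; rewrite /=; lia.
Qed.

Lemma eq_kb (C : nmodType) (A B : 'M[C]_(2 * k * s)%N) :
  (forall p q, (p < 2 * s)%N -> (q < 2 * s)%N -> kb A p q = kb B p q) -> A = B.
Proof. by move=> eqAB; apply: eq_kblock => p q; rewrite -!kbE eqAB. Qed.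

Lemma sum_pairs (V : nmodType) (f : nat -> V) (n : nat) :
  \sum_(r < 2 * n) f r = \sum_(j < n) (f (2 * j)%N + f (2 * j).+1).
Proof.
elim: n => [|n IHn]; first by rewrite !big_ord0.
by rewrite mulnS !big_ord_recr /= IHn addrA.
Qed.

Lemma kb_mul (C : pzSemiRingType) (A B : 'M[C]_(2 * k * s)%N) p q :
  (p < 2 * s)%N -> (q < 2 * s)%N ->
  kb (A *m B) p q = \sum_(j < s) (kb A p (2 * j) *m kb B (2 * j) q
                                + kb A p (2 * j).+1 *m kb B (2 * j).+1 q).
Proof.
move=> lt_p lt_q; rewrite -(sum_pairs (fun r => kb A p r *m kb B r q)).
rewrite -[p]/(val (Ordinal lt_p)) -[q]/(val (Ordinal lt_q)) kbE kblock_mul.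
by apply: eq_bigr => r _; rewrite !kbE.
Qed.

Lemma kb1 (C : pzSemiRingType) p q : (p < 2 * s)%N -> (q < 2 * s)%N ->
  kb (1%:M : 'M[C]_(2 * k * s)%N) p q = (p == q)%:R%:M.
Proof.
move=> lt_p lt_q.
rewrite -[p]/(val (Ordinal lt_p)) -[q]/(val (Ordinal lt_q)) kbE.
apply/matrixP => a b; rewrite kblockE !mxE -val_eqE /= tagnat.eq_Rank.
by rewrite -val_eqE /= !val_eqE; case: eqP => //= _; rewrite mul0rn.
Qed.

Lemma kb_trC (C : numClosedFieldType) (A : 'M[C]_(2 * k * s)%N) p q :
  kb (A^t*) p q = (kb A q p)^t*.
Proof.
rewrite /kb; case: insubP => [p' _ _|_]; case: insubP => [q' _ _|_];
  rewrite ?trmx0 ?map_mx0 //.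
by apply/matrixP => a b; rewrite !mxE !castmxE /= !mxE.
Qed.

(* Block [(b, b')] of a 2 x 2 block matrix, [false] standing for the first
   position and [true] for the second one. *)
Definition quad (C : Type) (b b' : bool) (B : 'M[C]_(k + k)) : 'M[C]_k :=
  if b then (if b' then drsubmx B else dlsubmx B)
  else (if b' then ursubmx B else ulsubmx B).

Definition shift (b : bool) (a : 'I_k) : 'I_(k + k) :=
  if b then rshift k a else lshift k a.

Lemma quadE (C : Type) b b' (B : 'M[C]_(k + k)) x y :
  quad b b' B x y = B (shift b x) (shift b' y).
Proof. by case: b; case: b'; rewrite !mxE. Qed.

Lemma shiftE b a : shift b a = (b * k + a)%N :> nat.
Proof. by case: b; rewrite /= ?mul1n ?mul0n. Qed.

(** Counting from 0, diagonal block [j] covers block indices [2j] and [2j + 1]: halving gives the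
    block, parity the position in it. *)
Lemma kb_left (C : nmodType) (B : nat -> 'M[C]_(k + k)) p q :
  (p < 2 * s)%N -> (q < 2 * s)%N ->
  kb (castmx (dim_G1 k s, dim_G1 k s) (\mxdiag_(j < s) B j)) p q =
  if p./2 == q./2 then quad (odd p) (odd q) (B p./2) else 0.
Proof.
move=> lt_p lt_q.
have bidx_pair (r : 'I_(2 * s)) a (h : (r./2 < s)%N) :
  cast_ord (esym (dim_G1 k s)) (bidx r a) =
  tagnat.Rank (p_ := fun=> (k + k)%N) (Ordinal h) (shift (odd r) a).
  apply/val_inj; apply: etrans (bidxE r a) (etrans _ (esym (Rank_const _ _))).
  by rewrite shiftE /=; have := odd_double_half r; nia.
rewrite -{1}[p]/(val (Ordinal lt_p)) -{1}[q]/(val (Ordinal lt_q)) kbE.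
have hp : (p./2 < s)%N by lia.
have hq : (q./2 < s)%N by lia.
apply/matrixP => a b; rewrite kblockE castmxE.
rewrite (bidx_pair (Ordinal lt_p) a hp) (bidx_pair (Ordinal lt_q) b hq) mxdiagE -val_eqE /=.
by case: eqP => _; rewrite ?quadE ?mxE.
Qed.

(** The leading [I_k] shifts the pairs to [2j + 1, 2j + 2], so [p] belongs to group [p.+1./2], and
    odd indices come first, hence the negated parities. *)
Lemma kb_right (hs : (0 < s)%N) (C : nzRingType) (B : nat -> 'M[C]_(k + k))
    (E : 'M[C]_k) p q :
  (p < 2 * s)%N -> (q < 2 * s)%N ->
  kb (castmx (dim_G2 k hs, dim_G2 k hs)
       (block_mx (1%:M : 'M[C]_k) 0
                 0 (block_mx (\mxdiag_(j < s.-1) B j) 0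
                             0 E))) p q =
  if p.+1./2 == q.+1./2 then
    if p == 0%N then 1%:M else
    if p == (2 * s).-1 then E else quad (~~ odd p) (~~ odd q) (B p.-1./2)
  else 0.
Proof.
move=> lt_p lt_q.
pose n := (\sum_(j < s.-1) (k + k))%N.
(* A block index is the leading one, the trailing one, or an interior one in pair [r.-1./2]. *)
have idx (r : nat) (h : (r < 2 * s)%N) (a : 'I_k) :
  let x := cast_ord (esym (dim_G2 k hs)) (bidx (Ordinal h) a) in
  [\/ r = 0%N /\ x = lshift (n + k) a,
      r = (2 * s).-1 /\ x = rshift k (rshift n a)
   |  exists h' : (r.-1./2 < s.-1)%N, [/\ r != 0%N, r != (2 * s).-1 &
        x = rshift k (lshift k (tagnat.Rank (p_ := fun=> (k + k)%N) (Ordinal h') (shift (~~ odd r) a)))]].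
  move=> x; have xE : x = (r * k + a)%N :> nat by exact: bidxE.
  have [r0|r_n0] := eqVneq r 0%N.
    by constructor 1; split=> //; apply: val_inj; apply: etrans xE _; rewrite r0.
  have [rl|r_nl] := eqVneq r (2 * s).-1.
    constructor 2; split=> //; apply: val_inj; apply: etrans xE _; rewrite rl /= /n.
    by rewrite sum_nat_const card_ord; nia.
  have h' : (r.-1./2 < s.-1)%N by lia.
  constructor 3; exists h'; split=> //; apply: val_inj.
  apply: etrans xE (etrans _ (esym (congr1 (addn k) (Rank_const _ _)))).
  rewrite shiftE /=.
  have -> : r = (r.-1./2 * 2 + 1 + ~~ odd r)%N by lia.
  have -> : (r.-1./2 * 2 + 1 + ~~ odd r).-1./2 = r.-1./2 by lia.
  have -> : odd (r.-1./2 * 2 + 1 + ~~ odd r) = odd r by lia.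
  nia.
rewrite -{1}[p]/(val (Ordinal lt_p)) -{1}[q]/(val (Ordinal lt_q)) kbE.
apply/matrixP => a b; rewrite kblockE castmxE.
case: (idx p lt_p a) => [[p0 ->]|[pl ->]|[hp [p_n0 p_nl ->]]];
case: (idx q lt_q b) => [[q0 ->]|[ql ->]|[hq [q_n0 q_nl ->]]];
rewrite ?(block_mxEul, block_mxEur, block_mxEdl, block_mxEdr);
  try by rewrite ifF ?mxE //; apply/eqP; lia.
- by rewrite p0 q0 !eqxx.
- have p_n0 : p != 0%N by lia.
  by rewrite ql -pl !eqxx (negPf p_n0).
rewrite mxdiagE -val_eqE /= (negPf p_n0) (negPf p_nl).
have -> : (p.-1./2 == q.-1./2) = (p.+1./2 == q.+1./2) by apply/eqP/eqP; lia.
by case: eqP => _; rewrite ?quadE ?mxE.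
Qed.
End NatBlocks.

(** * Pairs of block rows, and the CMV structure in terms of them *)

Section Groups.
Variables (k s : nat).

(** The strip of block column [q] within row pair [j], on which a single diagonal block of [G_1]
    acts. *)
Definition colg (C : nmodType) (A : 'M[C]_(2 * k * s)%N) (j q : nat) :
    'M[C]_(k + k, k) :=
  col_mx (kb A (2 * j) q) (kb A (2 * j).+1 q).

Definition diag2 (C : nmodType) (B : nat -> 'M[C]_(k + k)) : 'M[C]_(2 * k * s)%N :=
  castmx (dim_G1 k s, dim_G1 k s) (\mxdiag_(j < s) B j).

(** The name records the block sizes [k, 2k, ..., 2k, k]. *)
Definition diag121 (C : nzRingType) (hs : (0 < s)%N) (B : nat -> 'M[C]_(k + k))
    (E : 'M[C]_k) : 'M[C]_(2 * k * s)%N :=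
  castmx (dim_G2 k hs, dim_G2 k hs)
    (block_mx (1%:M : 'M[C]_k) 0 0 (block_mx (\mxdiag_(j < s.-1) B j) 0 0 E)).

Lemma left_factorP (C : numClosedFieldType) (G1 : 'M[C]_(2 * k * s)%N) :
  left_factor G1 <-> G1 \is unitarymx /\
    exists2 B, G1 = diag2 B & forall j, (j < s)%N -> factor_block (B j).
Proof.
split=> [[GU [B [GE BP]]]|[GU [B GE BP]]]; split=> //; last first.
  by exists (fun j : 'I_s => B j); split=> // j; apply: BP.
(* Indices from [s] on get the zero block, which is never read. *)
exists (fun j => oapp B 0 (insub j)).
  by rewrite GE; congr castmx; apply: eq_mxdiag => j; rewrite valK.
by move=> j lt_j; rewrite insubT /=.
Qed.

Lemma right_factorP (C : numClosedFieldType) (hs : (0 < s)%N)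
    (G2 : 'M[C]_(2 * k * s)%N) :
  right_factor hs G2 <-> G2 \is unitarymx /\
    exists B E, G2 = diag121 hs B E /\
      forall j, (j < s.-1)%N -> factor_block (B j).
Proof.
split=> [[GU [B [E [GE BP]]]]|[GU [B [E [GE BP]]]]]; split=> //; last first.
  by exists (fun j : 'I_s.-1 => B j), E; split=> // j; apply: BP.
exists (fun j => oapp B 0 (insub j)), E; split.
  rewrite GE; congr castmx; congr block_mx; congr block_mx.
  by apply: eq_mxdiag => j; rewrite valK.
by move=> j lt_j; rewrite insubT /=.
Qed.

Lemma colg_diag2 (C : pzSemiRingType) (B : nat -> 'M[C]_(k + k)) A j q :
  (j < s)%N -> (q < 2 * s)%N -> colg (diag2 B *m A) j q = B j *m colg A j q.
Proof.
move=> lt_j lt_q.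
(* The bit [b] selects the upper or lower half of the pair; only the summand of index [j]
   survives. *)
have row_j (b : bool) : kb (diag2 B *m A) (2 * j + b) q =
    quad b false (B j) *m kb A (2 * j) q + quad b true (B j) *m kb A (2 * j).+1 q.
  have lt_jb : (2 * j + b < 2 * s)%N by case: (b); lia.
  rewrite kb_mul //.
  have half_j : (2 * j + b)./2 = j by case: (b); lia.
  have odd_j : odd (2 * j + b) = b by case: (b); lia.
  have half0 i : (2 * i)./2 = i by lia.
  have half1 i : (2 * i).+1./2 = i by lia.
  rewrite (bigD1 (Ordinal lt_j)) //= big1 ?addr0.
    rewrite !kb_left; try lia.
    rewrite half_j half0 half1 eqxx odd_j.
    by rewrite /= mul2n odd_double.
  move=> i; rewrite -val_eqE /= => ne_ij; have lt_i := ltn_ord i.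
  rewrite !kb_left; try lia.
  by rewrite half_j half0 half1 eq_sym (negPf ne_ij) !mul0mx addr0.
have := row_j false; have := row_j true; rewrite addn0 addn1 /colg => -> ->.
by rewrite -{5}[B j]submxK mul_block_col.
Qed.

Lemma quad_trC (C : numClosedFieldType) b b' (B : 'M[C]_(k + k)) :
  quad b b' (B^t*) = (quad b' b B)^t*.
Proof. by apply/matrixP => i j; rewrite quadE !mxE quadE. Qed.

Lemma diag2_trC (C : numClosedFieldType) (B : nat -> 'M[C]_(k + k)) :
  (diag2 B)^t* = diag2 (fun j => (B j)^t*).
Proof.
apply: eq_kb => p q lt_p lt_q; rewrite kb_trC !kb_left // quad_trC eq_sym.
by case: eqP => [->|_] //; rewrite trmx0 map_mx0.
Qed.

Lemma colg_kb (C : nmodType) (A A' : 'M[C]_(2 * k * s)%N) :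
  (forall j q, (j < s)%N -> (q < 2 * s)%N -> colg A j q = colg A' j q) -> A = A'.
Proof.
move=> eqA; apply: eq_kb => p q lt_p lt_q.
have lt_p2 : (p./2 < s)%N by lia.
have /eq_col_mx[e0 e1] := eqA _ _ lt_p2 lt_q.
have [-> //|-> //] : p = (2 * p./2)%N \/ p = (2 * p./2).+1 by lia.
Qed.

Lemma diag2_unitary (C : numClosedFieldType) (B : nat -> 'M[C]_(k + k)) :
  (forall j, (j < s)%N -> B j \is unitarymx) -> diag2 B \is unitarymx.
Proof.
move=> BU; apply/unitarymxP; apply: colg_kb => j q lt_j lt_q.
(* The inserted factor [1] lets [colg_diag2] apply a second time. *)
rewrite colg_diag2 // -[(diag2 B)^t*]mulmx1 diag2_trC colg_diag2 // mulmxA.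
by rewrite (unitarymxP (BU j lt_j)) mul1mx.
Qed.

(** This is [G^t* *m G = 1] read blockwise, the sum being grouped by row pairs so that strips
    outside the support drop out. *)
Lemma colg_orthonormal (C : numClosedFieldType) (G : 'M[C]_(2 * k * s)%N) q q' :
  G \is unitarymx -> (q < 2 * s)%N -> (q' < 2 * s)%N ->
  \sum_(j < s) (colg G j q)^t* *m colg G j q' = (q == q')%:R%:M.
Proof.
rewrite -trmxC_unitary => /unitarymxP; rewrite trmxCK => GG lt_q lt_q'.
rewrite -(@kb1 k s) // -GG kb_mul //; apply: eq_bigr => j _.
by rewrite tr_col_mx map_row_mx mul_row_col !kb_trC.
Qed.

(** Counting from 0, row pair [j] lives in columns [2j - 1] to [2j + 2]. Since [(2 * j).-1] is 0 at
    [j = 0], the irregular first pair and its [R_1] fit the general formulas. *)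
Lemma cmv_structuredP (C : numClosedFieldType) (G : 'M[C]_(2 * k * s)%N) :
  (0 < s)%N ->
  cmv_structured G <->
  [/\ G \is unitarymx,
      forall j q, (j < s)%N -> ~~ (2 * j <= q.+1 <= 2 * j + 3)%N -> colg G j q = 0,
      forall j, (j.+1 < s)%N -> lower_trig_mx (kb G (2 * j) (2 * j).+2) /\
                               kb G (2 * j) (2 * j).+2 \in unitmx
    & forall j, (j < s)%N -> upper_trig_mx (kb G (2 * j).+1 (2 * j).-1) /\
                               kb G (2 * j).+1 (2 * j).-1 \in unitmx].
Proof.
move=> hs; split.
  case=> GU Z0 Z L R1 R.
  have kb_ord p q (lt_p : (p < 2 * s)%N) (lt_q : (q < 2 * s)%N) :
    kb G p q = kblock G (Ordinal lt_p) (Ordinal lt_q) by rewrite -kbE.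
  split=> //.
  - move=> j q lt_j far.
    have Zp p : p = (2 * j)%N \/ p = (2 * j).+1 -> kb G p q = 0.
      move=> pE; have lt_p : (p < 2 * s)%N by lia.
      have [lt_q|le_q] := ltnP q (2 * s); last by rewrite kb_oor // le_q orbT.
      rewrite (kb_ord _ _ lt_p lt_q).
      have [j0|j_n0] := eqVneq j 0%N; first by apply: Z0 => /=; lia.
      by apply: (Z j.+1) => /=; lia.
    by rewrite /colg !Zp ?col_mx0; auto.
  - move=> j lt_j.
    have lt_p : (2 * j < 2 * s)%N by lia.
    have lt_q : ((2 * j).+2 < 2 * s)%N by lia.
    by rewrite (kb_ord _ _ lt_p lt_q); apply: (L j.+1) => /=; lia.
  - move=> j lt_j.
    have lt_p : ((2 * j).+1 < 2 * s)%N by lia.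
    have lt_q : ((2 * j).-1 < 2 * s)%N by lia.
    rewrite (kb_ord _ _ lt_p lt_q).
    have [j0|j_n0] := eqVneq j 0%N; first by apply: R1 => /=; lia.
    by apply: (R j.+1) => /=; lia.
case=> GU Z L R.
have Z' j p q : (j < s)%N -> p = (2 * j)%N \/ p = (2 * j).+1 ->
  ~~ (2 * j <= q.+1 <= 2 * j + 3)%N -> kb G p q = 0.
  move=> lt_j pE far; move: (Z j q lt_j far); rewrite /colg -[0]vsubmxK.
  by move=> /eq_col_mx[e0 e1]; case: pE => ->; rewrite ?e0 ?e1; apply/matrixP => a b; rewrite !mxE.
split=> //.
- by move=> p q pE far; rewrite -kbE; apply: (Z' 0%N) => //; lia.
- by move=> j p q hj pE far; rewrite -kbE; apply: (Z' j.-1) => //; lia.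
- move=> j p q hj pE qE; rewrite -kbE.
  have -> : nat_of_ord p = (2 * j.-1)%N by lia.
  have -> : nat_of_ord q = (2 * j.-1).+2 by lia.
  by apply: L; lia.
- move=> p q [pE] [qE]; rewrite -kbE pE qE; exact: (R 0%N).
- move=> j p q hj pE qE; rewrite -kbE.
  have -> : nat_of_ord p = (2 * j.-1).+1 by lia.
  have -> : nat_of_ord q = (2 * j.-1).-1 by lia.
  by apply: R; lia.
Qed.

End Groups.

(** * From factors to CMV structure and back *)

Section Factorization.
Variables (C : numClosedFieldType) (k s : nat) (hs : (0 < s)%N).
Implicit Types G : 'M[C]_(2 * k * s)%N.

Lemma kb_diag121_out (B : nat -> 'M[C]_(k + k)) E p q :
  (p < 2 * s)%N -> (q < 2 * s)%N -> p.+1./2 != q.+1./2 ->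
  kb (diag121 hs B E) p q = 0.
Proof. by move=> lt_p lt_q ne; rewrite kb_right // (negPf ne). Qed.

Lemma kb_diag121_dl (B : nat -> 'M[C]_(k + k)) E j : (j < s.-1)%N ->
  kb (diag121 hs B E) (2 * j).+2 (2 * j).+1 = dlsubmx (B j).
Proof.
move=> lt_j; rewrite kb_right; try lia.
rewrite ifT; last by apply/eqP; lia.
rewrite !ifF; try by apply/eqP; lia.
have -> : (2 * j).+2.-1./2 = j by lia.
by rewrite mul2n /= odd_double.
Qed.

Lemma kb_diag121_ur (B : nat -> 'M[C]_(k + k)) E j : (j < s.-1)%N ->
  kb (diag121 hs B E) (2 * j).+1 (2 * j).+2 = ursubmx (B j).
Proof.
move=> lt_j; rewrite kb_right; try lia.
rewrite ifT; last by apply/eqP; lia.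
rewrite !ifF; try by apply/eqP; lia.
have -> : (2 * j).+1.-1./2 = j by lia.
by rewrite mul2n /= odd_double.
Qed.

(** In row pair [j], column [2j + 2] of [G2] has only a lower block and column [(2 * j).-1] only an
    upper one. The corner blocks of the product are thus products of two triangular blocks of the
    same kind, with [I_k] as second factor for [R_1]. *)
Lemma cmv_of_factors G1 G2 :
  left_factor G1 -> right_factor hs G2 -> cmv_structured (G1 *m G2).
Proof.
move=> /left_factorP[U1 [B G1E BP]] /right_factorP[U2 [B' [E [G2E B'P]]]].
have colE j q : (j < s)%N -> (q < 2 * s)%N ->
    colg (G1 *m G2) j q = B j *m colg G2 j q.
  by move=> lt_j lt_q; rewrite G1E colg_diag2.
have kb0 p q : (p < 2 * s)%N -> (q < 2 * s)%N -> p.+1./2 != q.+1./2 ->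
  kb G2 p q = 0 by rewrite G2E; exact: kb_diag121_out.
apply/cmv_structuredP => //; split.
- by rewrite mul_unitarymx.
- move=> j q lt_j far; have [lt_q|le_q] := ltnP q (2 * s); last first.
    by rewrite /colg !kb_oor ?le_q ?orbT // col_mx0.
  by rewrite colE // /colg !kb0 ?col_mx0 ?mulmx0 //; lia.
- move=> j lt_j; have := colE j (2 * j).+2; rewrite /colg.
  rewrite (kb0 (2 * j)%N); try lia.
  have ->: kb G2 (2 * j).+1 (2 * j).+2 = ursubmx (B' j).
    by rewrite G2E kb_diag121_ur //; lia.
  rewrite -{1}[B j]submxK mul_block_col !mulmx0 !add0r.
  have /BP/factor_blockP[_ _ lowB unB] : (j < s)%N by lia.
  have /B'P/factor_blockP[_ _ lowB' unB'] : (j < s.-1)%N by lia.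
  case/(_ _ _)/eq_col_mx => [||-> _]; try lia.
  by rewrite unitmx_mul unB unB'; split=> //; apply: lower_trig_mul.
- move=> j lt_j; have := colE j (2 * j).-1; rewrite /colg.
  rewrite (kb0 (2 * j).+1); try lia.
  rewrite -{1}[B j]submxK mul_block_col !mulmx0 !addr0.
  have /BP/factor_blockP[upB unB _ _] : (j < s)%N by [].
  case/(_ _ _)/eq_col_mx => [||_ ->]; try lia.
  case: j lt_j upB unB => [|j] lt_j upB unB.
    have -> : kb G2 0 0 = 1%:M by rewrite G2E kb_right //; lia.
    by rewrite mulmx1.
  have -> : (2 * j.+1)%N = (2 * j).+2 by lia.
  have -> : kb G2 (2 * j).+2 (2 * j).+1 = dlsubmx (B' j).
    by rewrite G2E kb_diag121_dl //; lia.
  have /B'P/factor_blockP[upB' unB' _ _] : (j < s.-1)%N by lia.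
  by rewrite unitmx_mul unB unB'; split=> //; apply: upper_trig_mul.
Qed.

Lemma factors_of_cmv G : cmv_structured G ->
  exists G1 G2, [/\ G = G1 *m G2, left_factor G1 & right_factor hs G2].
Proof.
move=> /(cmv_structuredP _ hs)[GU Z L R].
(* One frame per row pair, built from its first block column [(2 * j).-1]. *)
have [B BP] : exists B : nat -> 'M[C]_(k + k), forall j, (j < s)%N ->
    [/\ B j \is unitarymx, factor_block (B j)
      & exists X, [/\ (B j)^t* *m colg G j (2 * j).-1 = col_mx X 0,
          upper_trig_mx X /\ X \in unitmx
        & (colg G j (2 * j).-1)^t* *m colg G j (2 * j).-1 = 1%:M -> X = 1%:M]].
  suff /fin_all_exists[B BP] : forall j : 'I_s, exists B : 'M[C]_(k + k),
    [/\ B \is unitarymx, factor_block B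
      & exists X, [/\ B^t* *m colg G j (2 * j).-1 = col_mx X 0,
          upper_trig_mx X /\ X \in unitmx
        & (colg G j (2 * j).-1)^t* *m colg G j (2 * j).-1 = 1%:M -> X = 1%:M]].
    exists (fun j => oapp B 0 (insub j)) => j lt_j.
    by rewrite insubT /=; apply: (BP (Ordinal lt_j)).
  move=> j; have [up un] := R j (ltn_ord j).
  have [||B [X [BU BF BA Xu X1]]] := @unitary_frame C k (colg G j (2 * j).-1);
    rewrite ?col_mxKd //.
  by exists B; split=> //; exists X.
pose G1 := diag2 s B; pose H := G1^t* *m G.
have G1U : G1 \is unitarymx by apply: diag2_unitary => j /BP[].
have GE : G = G1 *m H by rewrite mulmxA (unitarymxP G1U) mul1mx.
have HU : H \is unitarymx by rewrite mul_unitarymx ?trmxC_unitary.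
have colH j q : (j < s)%N -> (q < 2 * s)%N ->
    colg H j q = (B j)^t* *m colg G j q.
  by move=> lt_j lt_q; rewrite /H diag2_trC colg_diag2.
have colGE j q : (j < s)%N -> (q < 2 * s)%N -> colg G j q = B j *m colg H j q.
  by move=> lt_j lt_q; rewrite {1}GE colg_diag2.
have Hcol0 j q : (j < s)%N -> (q < 2 * s)%N ->
    ~~ (2 * j <= q.+1 <= 2 * j + 3)%N -> colg H j q = 0.
  by move=> lt_j lt_q far; rewrite colH // Z // mulmx0.
(* If the supports of columns [q] and [q'] share only the row group [j], the
   orthonormality of the columns is visible within this group. *)
have orth j q q' : (j < s)%N -> (q < 2 * s)%N -> (q' < 2 * s)%N ->
    (forall i, (2 * i <= q.+1 <= 2 * i + 3)%N -> (2 * i <= q'.+1 <= 2 * i + 3)%N ->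
       (i < s)%N -> i = j) ->
    (colg H j q)^t* *m colg H j q' = (q == q')%:R%:M.
  move=> lt_j lt_q lt_q' only_j; rewrite -(colg_orthonormal HU lt_q lt_q').
  rewrite (bigD1 (Ordinal lt_j)) //= big1 ?addr0 // => i ne_ij.
  have lt_i := ltn_ord i.
  have [near|far] := boolP (2 * i <= q.+1 <= 2 * i + 3)%N; last first.
    by rewrite Hcol0 // trmx0 map_mx0 mul0mx.
  rewrite (Hcol0 i q') ?mulmx0 //; apply/negP => near'.
  by case/eqP: ne_ij; apply/val_inj; apply: only_j.
(* Column 0 meets no row pair but the first, so it is orthonormal there and [X = 1]. *)
have X_ j : (j < s)%N -> exists X, [/\ colg H j (2 * j).-1 = col_mx X 0,
    upper_trig_mx X, X \in unitmx & j = 0%N -> X = 1%:M].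
  move=> lt_j; have [BU _ [X [BX [upX unX] X1]]] := BP j lt_j.
  exists X; split=> //; first by rewrite colH //; lia.
  move=> j0; apply: X1.
  rewrite colGE //; last lia.
  rewrite trC_mul -mulmxA [X in _ *m X]mulmxA.
  rewrite -[(B j)^t* *m B j](_ : 1%:M = _); last first.
    by rewrite (mulmx1C (unitarymxP BU)).
  by rewrite mul1mx orth ?eqxx //; lia.
(* Columns [(2 * j).-1] and [q] share only row pair [j]; their orthogonality there reads
   [X^t* *m kb H (2 * j) q = 0], and [X] is invertible. *)
have upper0 j q : (j < s)%N -> (q < 2 * s)%N -> ((2 * j).+1 <= q <= (2 * j).+2)%N ->
    kb H (2 * j) q = 0.
  move=> lt_j lt_q near; have [X [XE _ unX _]] := X_ j lt_j.
  have := orth j (2 * j).-1 q lt_j; rewrite XE tr_col_mx map_row_mx mul_row_col.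
  rewrite trmx0 map_mx0 mul0mx addr0 => XH.
  have {}XH : X^t* *m kb H (2 * j) q = 0.
    rewrite XH; try lia.
    have -> : ((2 * j).-1 == q) = false by apply/eqP; lia.
    by rewrite mulr0n raddf0.
  have unXt : X^t* \in unitmx by rewrite map_unitmx unitmx_tr.
  by rewrite -[LHS](mulKmx unXt) XH mulmx0.
(* The last block column of row pair [j]; for the final pair, [2j + 2] is out of range. *)
pose l j := if (j.+1 < s)%N then (2 * j).+2 else (2 * j).+1.
have lP j : (j < s)%N -> (l j < 2 * s)%N && ((2 * j).+1 <= l j <= (2 * j).+2)%N.
  by rewrite /l; case: ifP; lia.
have colHl j : (j < s)%N -> colg H j (l j) = col_mx 0 (kb H (2 * j).+1 (l j)).
  by move=> lt_j; have /andP[lt_l near] := lP j lt_j; rewrite /colg upper0.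
(* The [L] block of [G] in this position is [ursubmx (B j)] times the block of [H], so triangular
   division applies. *)
have Y_ j : (j.+1 < s)%N -> lower_trig_mx (kb H (2 * j).+1 (2 * j).+2) /\
    kb H (2 * j).+1 (2 * j).+2 \in unitmx.
  move=> lt_j; have lt_j' : (j < s)%N by lia.
  have lE : l j = (2 * j).+2 by rewrite /l lt_j.
  have := colGE j (l j) lt_j'; rewrite colHl // lE -{1}[B j]submxK.
  rewrite mul_block_col !mulmx0 !add0r => /(_ _)/eq_col_mx[|Ltop _]; first lia.
  have [lowL unL] := L j lt_j; rewrite Ltop in lowL unL.
  have [_ /factor_blockP[_ _ lowB unB] _] := BP j lt_j'.
  split; first exact: lower_trig_divl lowL.
  by move: unL; rewrite unitmx_mul => /andP[].
have unl j : (j < s)%N -> kb H (2 * j).+1 (l j) \in unitmx.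
  move=> lt_j; have [lt_j1|le_j1] := ltnP j.+1 s.
    by rewrite /l lt_j1; case: (Y_ j lt_j1).
  (* Column [2s - 1] meets only the last row pair, so its one nonzero block in [H] is unitary. *)
  have lE : l j = (2 * j).+1 by rewrite /l ltnNge le_j1.
  have := orth j (l j) (l j) lt_j; rewrite colHl // tr_col_mx map_row_mx mul_row_col.
  rewrite mulmx0 add0r eqxx => YY.
  have lt_l : (l j < 2 * s)%N by lia.
  have {}YY := YY lt_l lt_l.
  by case/mulmx1_unit: (YY ltac:(lia)).
(* The mirror image of [upper0]: columns [l j] and [q] share only row pair [j]. *)
have lower0 j q : (j < s)%N -> (q < 2 * s)%N -> (2 * j <= q.+1 <= (2 * j).+1)%N ->
    kb H (2 * j).+1 q = 0.
  move=> lt_j lt_q near; have /andP[lt_l nearl] := lP j lt_j.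
  have := orth j (l j) q lt_j; rewrite colHl // tr_col_mx map_row_mx mul_row_col.
  rewrite trmx0 map_mx0 mul0mx add0r => YH.
  have {}YH : (kb H (2 * j).+1 (l j))^t* *m kb H (2 * j).+1 q = 0.
    rewrite YH //.
      have -> : (l j == q) = false by apply/eqP; lia.
      by rewrite mulr0n raddf0.
    by move=> i; move: nearl; rewrite /l; case: ifP => _ _; lia.
  have unYt : (kb H (2 * j).+1 (l j))^t* \in unitmx.
    by rewrite map_unitmx unitmx_tr unl.
  by rewrite -[LHS](mulKmx unYt) YH mulmx0.
have H0 p q : (p < 2 * s)%N -> (q < 2 * s)%N -> p.+1./2 != q.+1./2 -> kb H p q = 0.
  move=> lt_p lt_q ne; have lt_p2 : (p./2 < s)%N by lia.
  have [near|far] := boolP (2 * p./2 <= q.+1 <= 2 * p./2 + 3)%N; last first.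
    have := Hcol0 _ _ lt_p2 lt_q far; rewrite /colg -[0]vsubmxK => /eq_col_mx[e0 e1].
    have [->|->] : p = (2 * p./2)%N \/ p = (2 * p./2).+1 by lia.
      by rewrite e0; apply/matrixP => a b; rewrite !mxE.
    by rewrite e1; apply/matrixP => a b; rewrite !mxE.
  have [pE|pE] : p = (2 * p./2)%N \/ p = (2 * p./2).+1 by lia.
    by rewrite pE upper0 //; lia.
  by rewrite pE lower0 //; lia.
(* The interior blocks of [G_2] straddle two row pairs: the lower half of pair [j] and the upper
   half of pair [j + 1]. *)
pose B' j := block_mx (kb H (2 * j).+1 (2 * j).+1) (kb H (2 * j).+1 (2 * j).+2)
                      (kb H (2 * j).+2 (2 * j).+1) (kb H (2 * j).+2 (2 * j).+2).
exists G1, H; split=> //.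
  by apply/left_factorP; split=> //; exists B => // j /BP[].
apply/right_factorP; split=> //.
exists B', (kb H (2 * s).-1 (2 * s).-1); split; last first.
  move=> j lt_j; apply/factor_blockP; rewrite /B' block_mxKdl block_mxKur.
  (* The upper right corner is the [Y] block of pair [j], the lower left one the [X] of pair
     [j + 1]. *)
  have [|lowY unY] := Y_ j; first lia.
  have [|X [XE upX unX _]] := X_ j.+1; first lia.
  move: XE; rewrite /colg; have -> : (2 * j.+1)%N = (2 * j).+2 by lia.
  by move=> /eq_col_mx[-> _]; split.
apply: eq_kb => p q lt_p lt_q; rewrite kb_right //.
case: eqP => [eq_pq|/eqP ne]; last exact: H0.
case: eqP => [p0|/eqP p_n0].
  have -> : q = 0%N by lia.
  have [X [/eq_col_mx[HX _] _ _ X1]] := X_ 0%N hs.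
  by rewrite p0 HX X1.
case: eqP => [pE|/eqP p_nl].
  by have -> : q = (2 * s).-1 by [lia]; rewrite pE.
set j := p.-1./2.
have [pE|pE] : p = (2 * j).+1 \/ p = (2 * j).+2 by lia.
  have [qE|qE] : q = (2 * j).+1 \/ q = (2 * j).+2 by lia.
    by rewrite pE qE mul2n /= odd_double /= /B' block_mxKul mul2n.
  by rewrite pE qE mul2n /= odd_double /= /B' block_mxKur mul2n.
have [qE|qE] : q = (2 * j).+1 \/ q = (2 * j).+2 by lia.
  by rewrite pE qE mul2n /= odd_double /= /B' block_mxKdl mul2n.
by rewrite pE qE mul2n /= odd_double /= /B' block_mxKdr mul2n.
Qed.

End Factorization.

(** * Both directions over the complex numbers [R[i]] *)

Theorem lemma2p4 (R : realType) (k s : nat) (hk : (0 < k)%N) (hs : (0 < s)%N) :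
  (forall G : 'M[R[i]]_(2 * k * s)%N, cmv_structured G ->
     exists G1 G2 : 'M[R[i]]_(2 * k * s)%N,
       [/\ G = G1 *m G2, left_factor G1 & right_factor hs G2]) /\
  (forall G G1 G2 : 'M[R[i]]_(2 * k * s)%N,
     G = G1 *m G2 -> left_factor G1 -> right_factor hs G2 ->
     cmv_structured G).
Proof.
split=> [G|G G1 G2 ->]; first exact: factors_of_cmv.
exact: cmv_of_factors.
Qed.
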